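(* Let $(x(t))_{t\ge 0}$ be a trajectory of the mixed Hegselmann-Krause model with $n$ agents, opinions in $\mathbf{R}^d$, confidence bound $\epsilon>0$ and stubbornness degrees $\alpha_i(t)\in[0,1]$. Assume that $$\limsup_{t\to\infty}\ \max_{i\in[n]}\alpha_i(t)<1.$$ Then, for any $\delta>0$, every component of the profile is $\delta$-trivial in finite time, i.e., $$\tau_{\alpha,\delta}:=\inf\{t\ge 0:\text{every component of }\mathscr{G}(t)\text{ is }\delta\text{-trivial}\}<\infty.$$
   Context: Notation: $[n]=\{1,\dots,n\}$ with $n\ge 1$, $\mathbf{N}=\{0,1,2,\dots\}$, $\|\cdot\|$ is the Euclidean norm on $\mathbf{R}^d$; times $t$ range over $\mathbf{N}$, and $\inf\varnothing=\infty$. Mixed Hegselmann-Krause model: given $\epsilon>0$, arbitrary initial opinions $x_1(0),\dots,x_n(0)\in\mathbf{R}^d$ and given numbers $\alpha_i(t)\in[0,1]$ ($i\in[n]$, $t\in\mathbf{N}$), the opinions evolve by $$x_i(t+1)=\alpha_i(t)\,x_i(t)+\frac{1-\alpha_i(t)}{|N_i(t)|}\sum_{j\in N_i(t)}x_j(t),\qquad N_i(t)=\{j\in[n]:\|x_i(t)-x_j(t)\|\le\epsilon\}$$ (so $i\in N_i(t)$). The profile $\mathscr{G}(t)$ is the undirected graph with vertex set $[n]$ and edge set $\{ij: i\ne j,\ \|x_i(t)-x_j(t)\|\le\epsilon\}$. For $\delta>0$, a (connected) component $G$ of $\mathscr{G}(t)$ is $\delta$-trivial if $\|x_i(t)-x_j(t)\|\le\delta$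 for all vertices $i,j$ of $G$. *)

(* Defs.v *)
From mathcomp Require Import all_boot all_order all_algebra.
From mathcomp Require Import all_classical all_reals all_analysis.
Set Implicit Arguments.
Unset Strict Implicit.
Unset Printing Implicit Defensive.
Import Order.TTheory GRing.Theory Num.Theory.
Local Open Scope classical_set_scope.
Local Open Scope ring_scope.

(* The library's norm `|v| on row vectors is the sup norm, hence this one. *)
Definition enorm (R : realType) (d : nat) (v : 'rV[R]_d) : R :=
  Num.sqrt (\sum_(k < d) v ord0 k ^+ 2).

Definition neighbours (R : realType) (n d : nat) (eps : R)
    (y : 'I_n -> 'rV[R]_d) (i : 'I_n) : {set 'I_n} :=
  [set j : 'I_n | enorm (y i - y j) <= eps]%SET.

Definition mixed_HK (R : realType) (n d : nat) (eps : R)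
    (alpha : nat -> 'I_n -> R) (x : nat -> 'I_n -> 'rV[R]_d) : Prop :=
  forall (t : nat) (i : 'I_n),
    x t.+1 i = alpha t i *: x t i
      + ((1 - alpha t i) / #|neighbours eps (x t) i|%:R)
          *: \sum_(j in neighbours eps (x t) i) x t j.

Definition profile (R : realType) (n d : nat) (eps : R)
    (y : 'I_n -> 'rV[R]_d) : rel 'I_n :=
  fun i j => (i != j) && (enorm (y i - y j) <= eps).

(* Vertex sets of the connected components of a graph given by a symmetric
   relation e; symmetry makes connect e an equivalence. *)
Definition components (T : finType) (e : rel T) : {set {set T}} :=
  equivalence_partition (connect e) [set: T]%SET.

Definition delta_trivial (R : realType) (n d : nat) (delta : R)
    (y : 'I_n -> 'rV[R]_d) (G : {set 'I_n}) : Prop :=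
  forall i j : 'I_n, i \in G -> j \in G -> enorm (y i - y j) <= delta.

(* The index -oo never matters when 0 < n: this is then the maximum of the
   alpha i. *)
Definition max_stubbornness (R : realType) (n : nat) (a : 'I_n -> R) : \bar R :=
  \big[Order.max/-oo%E]_(i < n) (a i)%:E.

(* An infimum of times in [0, +oo], equal to +oo when there is no such time. *)
Definition tau (R : realType) (n d : nat) (eps delta : R)
    (x : nat -> 'I_n -> 'rV[R]_d) : \bar R :=
  ereal_inf [set (t%:R)%:E | t in [set t : nat |
    forall G : {set 'I_n}, G \in components (profile eps (x t)) ->
      delta_trivial delta (x t) G]].

(* Main.v *)
Require Import Defs.
From mathcomp Require Import all_boot all_order all_algebra.
From mathcomp Require Import all_classical all_reals all_analysis.
From mathcomp Require Import ring lra.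
Set Implicit Arguments.
Unset Strict Implicit.
Unset Printing Implicit Defensive.
Import Order.TTheory GRing.Theory Num.Theory.
Local Open Scope ring_scope.

(** The truncated energy Z(y) = sum_(i,j) min(|y_i - y_j|^2, eps^2) is a
    Lyapunov function. The function s |-> min(s, eps^2) is concave with
    supergradient 1 for s <= eps^2 and 0 beyond, so the variation of Z over one
    step is at most that of the Dirichlet form sum |y_i - y_j|^2 taken over the
    edges of the current profile ([energy_linearised]).

    On a fixed graph everything splits into coordinates. In each one an agent
    moves by u_i = - (1 - alpha_i) / deg(i) * w_i, where w is the Laplacian of
    the opinions, and summation by parts shows that the Dirichlet form loses at
    least 4 sum u_i^2 ([averaging_dissipation]). From some time on
    1 - alpha_i >= c > 0, hence |u_i| >= (c / n) |w_i|, and Z loses a fixed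
    multiple of W = sum |w_i|^2 ([energy_decay]). As Z >= 0, there must be
    arbitrarily late times at which W is as small as desired
    ([bounded_descent]).

    At such a time the sum of |x_i - x_j|^2 over the edges is
    2 sum <x_i, w_i>; opinions stay bounded because every step takes convex
    combinations ([mixed_HK_bounded]), so this sum is small as well
    ([edges_le_laplacian]). All edges are then short, and since two agents of a
    component are joined by a path with fewer than n edges, every component has
    small diameter ([components_delta_trivial]). *)

(** * Dissipation of the Dirichlet form on a graph *)

(** Loops contribute nothing, so that [e] may be taken reflexive; the degrees
    [#|e i|] below then count the vertex itself, as in the model. *)
Definition laplacian (R : realFieldType) (I : finType) (e : rel I)
    (p : I -> R) (i : I) : R := \sum_(j | e i j) (p i - p j).

Lemma degree_gt0 (I : finType) (e : rel I) (i : I) :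
  reflexive e -> (0 < #|e i|)%N.
Proof.
by move=> e_refl; apply/card_gt0P; exists i; rewrite unfold_in e_refl.
Qed.

Lemma sum_sym_rel (R : realFieldType) (I : finType) (e : rel I)
    (F : I -> I -> R) :
  symmetric e ->
  \sum_i \sum_(j | e i j) F i j = \sum_i \sum_(j | e i j) F j i.
Proof.
move=> e_sym; rewrite (exchange_big_dep xpredT) //=.
by apply: eq_bigr => i _; apply: eq_bigl => j; rewrite e_sym.
Qed.

(** Summation by parts: swapping the ends of the edges turns the term with
    [q j] into the one with [q i]. *)
Lemma dirichlet_form (R : realFieldType) (I : finType) (e : rel I)
    (p q : I -> R) :
  symmetric e ->
  \sum_i \sum_(j | e i j) (p i - p j) * (q i - q j)
    = 2 * \sum_i laplacian e p i * q i.
Proof.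
move=> e_sym.
have -> : \sum_i \sum_(j | e i j) (p i - p j) * (q i - q j)
        = \sum_i \sum_(j | e i j) (p i - p j) * q i
        + \sum_i \sum_(j | e i j) (p j - p i) * q j.
  rewrite -big_split /=; apply: eq_bigr => i _.
  by rewrite -big_split /=; apply: eq_bigr => j _; ring.
rewrite -(sum_sym_rel (fun i j => (p i - p j) * q i) e_sym) -mulr2n mulr_natl.
by congr (_ *+ _); apply: eq_bigr => i _; rewrite /laplacian mulr_suml.
Qed.

(** This is (a - b)^2 <= 2 a^2 + 2 b^2 on every edge. On loops the left-hand
    side vanishes, which saves 4 (q i)^2 per vertex: this is where the -1 comes
    from, and it is what makes the dissipation below strict. *)
Lemma gradient_le_degree (R : realFieldType) (I : finType) (e : rel I)
    (q : I -> R) :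
  symmetric e -> reflexive e ->
  \sum_i \sum_(j | e i j) (q i - q j) ^+ 2
    <= 4 * \sum_i (#|e i|%:R - 1) * q i ^+ 2.
Proof.
move=> e_sym e_refl.
have -> : 4 * \sum_i (#|e i|%:R - 1) * q i ^+ 2
    = \sum_i \sum_(j | e i j)
        (2 * q i ^+ 2 + 2 * q j ^+ 2 - (j == i)%:R * (4 * q i ^+ 2)).
  have deg i : \sum_(j | e i j) q i ^+ 2 = #|e i|%:R * q i ^+ 2.
    by rewrite sumr_const mulr_natl.
  have self i : \sum_(j | e i j) (j == i)%:R * (4 * q i ^+ 2) = 4 * q i ^+ 2.
    rewrite (bigD1 i) ?e_refl //= eqxx mul1r big1 ?addr0 // => j.
    by case/andP=> _ /negPf ->; rewrite mul0r.
  transitivity (2 * (\sum_i \sum_(j | e i j) q i ^+ 2)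
      + 2 * (\sum_i \sum_(j | e i j) q j ^+ 2) - \sum_i 4 * q i ^+ 2).
    rewrite -(sum_sym_rel (fun i j => q i ^+ 2) e_sym).
    rewrite (eq_bigr _ (fun i _ => deg i)) !mulr_sumr.
    rewrite -!big_split -sumrB /=; apply: eq_bigr => i _; ring.
  rewrite !mulr_sumr -!big_split -sumrB /=; apply: eq_bigr => i _.
  by rewrite sumrB big_split /= self !mulr_sumr.
apply: ler_sum => i _; apply: ler_sum => j _.
have [-> | _] := eqVneq j i; first by rewrite subrr expr0n /=; lra.
by have := sqr_ge0 (q i + q j); rewrite mul0r; lra.
Qed.

(** With u = q - p, the form changes by 4 sum w_i u_i + sum (u_i - u_j)^2. As
    u_i = - b_i / deg(i) * w_i with b_i <= 1, the first term is at most
    - 4 sum deg(i) u_i^2, and the second is at most 4 sum (deg(i) - 1) u_i^2. *)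
Lemma averaging_dissipation (R : realFieldType) (I : finType) (e : rel I)
    (b p q : I -> R) :
  symmetric e -> reflexive e -> (forall i, 0 <= b i <= 1) ->
  (forall i, q i - p i = - (b i / #|e i|%:R) * laplacian e p i) ->
  \sum_i \sum_(j | e i j) (q i - q j) ^+ 2
    <= \sum_i \sum_(j | e i j) (p i - p j) ^+ 2
       - 4 * \sum_i (q i - p i) ^+ 2.
Proof.
move=> e_sym e_refl b01 step; set u := fun i => q i - p i.
have expand : \sum_i \sum_(j | e i j) (q i - q j) ^+ 2
    = \sum_i \sum_(j | e i j) (p i - p j) ^+ 2
      + 4 * \sum_i laplacian e p i * u i
      + \sum_i \sum_(j | e i j) (u i - u j) ^+ 2.
  have -> : 4 * \sum_i laplacian e p i * u i
      = 2 * \sum_i \sum_(j | e i j) (p i - p j) * (u i - u j).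
    by rewrite dirichlet_form // mulrA -natrM.
  rewrite mulr_sumr -!big_split /=; apply: eq_bigr => i _.
  rewrite mulr_sumr -!big_split /=; apply: eq_bigr => j _.
  by rewrite /u; ring.
have work : \sum_i laplacian e p i * u i <= - \sum_i #|e i|%:R * u i ^+ 2.
  rewrite -sumrN; apply: ler_sum => i _; rewrite /u step.
  have N0 : 0 < #|e i|%:R :> R.
    by rewrite ltr0n degree_gt0.
  set w := laplacian _ _ _; have /andP[b0 b1] := b01 i.
  (* With D = b / N * w^2 the claim reads - D <= - b * D. *)
  have -> : #|e i|%:R * (- (b i / #|e i|%:R) * w) ^+ 2
      = b i * (b i / #|e i|%:R * w ^+ 2) by field; rewrite gt_eqF.
  have : 0 <= b i / #|e i|%:R * w ^+ 2.
    by rewrite mulr_ge0 ?sqr_ge0 // divr_ge0 // ltW.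
  nra.
have := gradient_le_degree u e_sym e_refl.
have -> : \sum_i (#|e i|%:R - 1) * u i ^+ 2
    = \sum_i #|e i|%:R * u i ^+ 2 - \sum_i u i ^+ 2.
  by rewrite -sumrB; apply: eq_bigr => i _; ring.
rewrite expand -/u; lra.
Qed.

Lemma laplacian_le_step (R : realFieldType) (I : finType) (e : rel I)
    (p : I -> R) (i : I) (b c u : R) :
  reflexive e -> 0 <= c <= b ->
  u = - (b / #|e i|%:R) * laplacian e p i ->
  (c / #|I|%:R) ^+ 2 * laplacian e p i ^+ 2 <= u ^+ 2.
Proof.
move=> e_refl /andP[c0 cb] ->; rewrite [X in _ <= X]exprMn sqrrN.
have N0 := degree_gt0 i e_refl.
apply: ler_wpM2r; first exact: sqr_ge0.
have I0 : (0 < #|I|)%N by apply: leq_trans N0 (max_card _).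
rewrite lerXn2r ?nnegrE ?divr_ge0 // ?(le_trans c0) //.
by rewrite ler_pM ?invr_ge0 // lef_pV2 ?posrE ?ltr0n // ler_nat max_card.
Qed.

(** The left-hand side is 2 sum p_i w_i, and 2 p w <= s p^2 + w^2 / s. Bounding
    all of [p] instead of centring it on each component avoids any discussion
    of components or spectral gaps; the weight [s] is to be chosen later, small
    but large compared with the Laplacian. *)
Lemma edges_le_laplacian (R : realFieldType) (I : finType) (e : rel I)
    (p : I -> R) (B s : R) :
  symmetric e -> 0 < s -> (forall i, `|p i| <= B) ->
  \sum_i \sum_(j | e i j) (p i - p j) ^+ 2
    <= s * (#|I|%:R * B ^+ 2) + (\sum_i laplacian e p i ^+ 2) / s.
Proof.
move=> e_sym s0 pB.
under eq_bigr => i _ do under eq_bigr => j _ do rewrite expr2.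
rewrite dirichlet_form //.
have -> : s * (#|I|%:R * B ^+ 2) = \sum_(i : I) s * B ^+ 2.
  by rewrite sumr_const -[RHS]mulr_natl mulrCA.
rewrite mulr_sumr mulr_suml -big_split /=; apply: ler_sum => i _.
set w := laplacian _ _ _.
have pB2 : p i ^+ 2 <= B ^+ 2.
  rewrite -real_normK ?num_real // lerXn2r ?nnegrE //.
  exact: le_trans (pB i).
have : 0 <= (s * p i - w) ^+ 2 / s by rewrite divr_ge0 ?sqr_ge0 // ltW.
have -> : (s * p i - w) ^+ 2 / s = s * p i ^+ 2 - 2 * (w * p i) + w ^+ 2 / s.
  by field; rewrite gt_eqF.
nra.
Qed.

(** A repetition-free path has fewer than [#|I|] edges. *)
Lemma connect_dist (R : realFieldType) (I : finType) (e : rel I)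
    (p : I -> R) (g : R) (i j : I) :
  0 <= g -> (forall a b, e a b -> `|p a - p b| <= g) ->
  connect e i j -> `|p i - p j| <= #|I|%:R * g.
Proof.
move=> g0 short /connectP[s /shortenP[{}s es us _] ->].
apply: (@le_trans _ _ ((size s)%:R * g)); last first.
  rewrite ler_wpM2r // ler_nat.
  apply: leq_trans (leqnSn _) _.
  by rewrite -[_.+1]/(size (i :: s)) -(card_uniqP us) max_card.
move: es; clear us; elim: s i => [|k s IH] i /=.
  by rewrite subrr normr0 mul0r.
case/andP=> eik es; apply: le_trans (ler_distD (p k) _ _) _.
rewrite -natr1 mulrDl mul1r [leRHS]addrC lerD //; [exact: short | exact: IH].
Qed.

(** Otherwise [f] would lose more than [k * h] at every step from [T] on and
    would become negative. *)
Lemma bounded_descent (R : archiRealFieldType) (f g : nat -> R) (T : nat)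
    (k h : R) :
  0 < k -> 0 < h -> (forall t, 0 <= f t) ->
  (forall t, (T <= t)%N -> f t.+1 <= f t - k * g t) ->
  exists2 t, (T <= t)%N & g t <= h.
Proof.
move=> k0 h0 f0 fg; apply/not_exists2P => big.
have drop m : f (T + m)%N <= f T - m%:R * (k * h).
  elim: m => [|m IH]; first by rewrite addn0 mul0r subr0.
  rewrite addnS -natr1; have := fg (T + m)%N (leq_addr _ _).
  have [|/negP] := big (T + m)%N; first by rewrite leq_addr.
  rewrite -ltNge => hg; nra.
have kh0 : 0 < k * h by rewrite mulr_gt0.
have := archi_boundP (divr_ge0 (f0 T) (ltW kh0)).
rewrite ltr_pdivrMr // => fb.
set m := Num.bound _ in fb; have := drop m; have := f0 (T + m)%N.
lra.
Qed.

(** * The truncated energy along a trajectory *)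

Definition sqdist (R : realType) (d : nat) (u v : 'rV[R]_d) : R :=
  \sum_(k < d) (u ord0 k - v ord0 k) ^+ 2.

(** Unlike the profile, this relation has loops: it is the graph over which the
    model averages. *)
Definition close (R : realType) (n d : nat) (eps : R)
    (y : 'I_n -> 'rV[R]_d) : rel 'I_n :=
  fun i j => enorm (y i - y j) <= eps.

Definition energy (R : realType) (n d : nat) (eps : R)
    (y : 'I_n -> 'rV[R]_d) : R :=
  \sum_i \sum_j Num.min (sqdist (y i) (y j)) (eps ^+ 2).

Lemma sqdistC (R : realType) (d : nat) (u v : 'rV[R]_d) :
  sqdist u v = sqdist v u.
Proof. by apply: eq_bigr => k _; rewrite -sqrrN opprB. Qed.

Lemma sqdist_ge0 (R : realType) (d : nat) (u v : 'rV[R]_d) : 0 <= sqdist u v.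
Proof. by apply: sumr_ge0 => k _; exact: sqr_ge0. Qed.

Lemma enorm_sub_le (R : realType) (d : nat) (u v : 'rV[R]_d) (r : R) :
  0 <= r -> (enorm (u - v) <= r) = (sqdist u v <= r ^+ 2).
Proof.
move=> r0; rewrite /enorm -{1}(ger0_norm r0) -sqrtr_sqr ler_sqrt ?sqr_ge0 //.
by congr (_ <= _); apply: eq_bigr => k _; rewrite !mxE.
Qed.

Lemma close_refl (R : realType) (n d : nat) (eps : R) (y : 'I_n -> 'rV[R]_d) :
  0 <= eps -> reflexive (close eps y).
Proof.
move=> eps0 i; rewrite /close enorm_sub_le // /sqdist big1 ?sqr_ge0 // => k _.
by rewrite subrr expr0n.
Qed.

Lemma close_sym (R : realType) (n d : nat) (eps : R) (y : 'I_n -> 'rV[R]_d) :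
  0 <= eps -> symmetric (close eps y).
Proof. by move=> eps0 i j; rewrite /close !enorm_sub_le // sqdistC. Qed.

Lemma card_neighbours (R : realType) (n d : nat) (eps : R)
    (y : 'I_n -> 'rV[R]_d) (i : 'I_n) :
  #|neighbours eps y i| = #|close eps y i|.
Proof. by apply: eq_card => j; rewrite inE unfold_in. Qed.

Lemma mixed_HK_step (R : realType) (n d : nat) (eps : R)
    (alpha : nat -> 'I_n -> R) (x : nat -> 'I_n -> 'rV[R]_d)
    (t : nat) (i : 'I_n) (k : 'I_d) :
  0 <= eps -> mixed_HK eps alpha x ->
  x t.+1 i ord0 k - x t i ord0 k
    = - ((1 - alpha t i) / #|close eps (x t) i|%:R)
        * laplacian (close eps (x t)) (fun j => x t j ord0 k) i.
Proof.
move=> eps0 hx; rewrite hx card_neighbours !mxE summxE.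
rewrite (eq_bigl (close eps (x t) i)); last by move=> j; rewrite inE.
rewrite /laplacian sumrB sumr_const -mulr_natl.
have N0 : #|close eps (x t) i|%:R != 0 :> R.
  by rewrite pnatr_eq0 -lt0n degree_gt0 //; exact: close_refl.
by field.
Qed.

(** Each new opinion is a convex combination of old ones, so that any bound on
    the coordinates at time 0 persists. *)
Lemma mixed_HK_bounded (R : realType) (n d : nat) (eps : R)
    (alpha : nat -> 'I_n -> R) (x : nat -> 'I_n -> 'rV[R]_d) :
  0 <= eps -> (forall t i, 0 <= alpha t i <= 1) -> mixed_HK eps alpha x ->
  exists B, forall t i k, `|x t i ord0 k| <= B.
Proof.
move=> eps0 a01 hx; exists (\sum_i \sum_k `|x 0%N i ord0 k|).
set B := \sum_i _; elim=> [|t IH] i k.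
  rewrite /B (bigD1 i) //= (bigD1 k) //= -addrA lerDl addr_ge0 ?sumr_ge0 //.
  by move=> j _; rewrite sumr_ge0.
have /andP[a0 a1] := a01 t i.
rewrite hx card_neighbours !mxE summxE.
rewrite (eq_bigl (close eps (x t) i)); last by move=> j; rewrite inE.
have N0 : 0 < #|close eps (x t) i|%:R :> R.
  by rewrite ltr0n degree_gt0 //; exact: close_refl.
have avg : `|\sum_(j | close eps (x t) i j) x t j ord0 k|
    <= #|close eps (x t) i|%:R * B.
  apply: le_trans (ler_norm_sum _ _ _) _.
  by rewrite mulr_natl -sumr_const; apply: ler_sum => j _; exact: IH.
apply: le_trans (ler_normD _ _) _; rewrite !normrM normfV.
rewrite (ger0_norm a0) (@ger0_norm _ (1 - _)) ?subr_ge0 // (gtr0_norm N0).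
have -> : B = alpha t i * B
    + (1 - alpha t i) / #|close eps (x t) i|%:R * (#|close eps (x t) i|%:R * B).
  by field; rewrite gt_eqF.
by rewrite lerD // ler_wpM2l // divr_ge0 ?subr_ge0 // ltW.
Qed.

Lemma energy_ge0 (R : realType) (n d : nat) (eps : R)
    (y : 'I_n -> 'rV[R]_d) : 0 <= energy eps y.
Proof.
apply: sumr_ge0 => i _; apply: sumr_ge0 => j _.
by rewrite le_min sqdist_ge0 sqr_ge0.
Qed.

(** Pairs that are not close already contribute the maximal value [eps ^+ 2] to
    the energy of [y], so that they cannot increase it; on close pairs the
    truncation is inactive for [y] and only lowers the value for [z]. *)
Lemma energy_linearised (R : realType) (n d : nat) (eps : R)
    (y z : 'I_n -> 'rV[R]_d) :
  0 <= eps ->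
  energy eps z - energy eps y
    <= \sum_i \sum_(j | close eps y i j) sqdist (z i) (z j)
       - \sum_i \sum_(j | close eps y i j) sqdist (y i) (y j).
Proof.
move=> eps0; rewrite /energy -!sumrB; apply: ler_sum => i _.
rewrite -!sumrB [leRHS]big_mkcond; apply: ler_sum => j _ /=.
rewrite /close enorm_sub_le //; case: (leP (sqdist (y i) _)) => _.
  by rewrite lerD2r ge_min lexx.
by rewrite subr_le0 ge_min lexx orbT.
Qed.

(** With the interaction graph of time [t] held fixed, each coordinate
    contributes its own dissipation; a step is at least [c / n] times the
    Laplacian because degrees are at most [n]. *)
Lemma energy_decay (R : realType) (n d : nat) (eps : R)
    (alpha : nat -> 'I_n -> R) (x : nat -> 'I_n -> 'rV[R]_d) (t : nat) (c : R) :
  0 <= eps -> 0 <= c -> (forall i, c <= 1 - alpha t i <= 1) ->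
  mixed_HK eps alpha x ->
  energy eps (x t.+1) <= energy eps (x t)
    - 4 * (c / n%:R) ^+ 2
      * \sum_(k < d) \sum_i
          laplacian (close eps (x t)) (fun j => x t j ord0 k) i ^+ 2.
Proof.
move=> eps0 c0 cb hx; set e := close eps (x t).
have e_refl : reflexive e by exact: close_refl.
have coord (y : 'I_n -> 'rV[R]_d) :
    \sum_i \sum_(j | e i j) sqdist (y i) (y j)
    = \sum_k \sum_i \sum_(j | e i j) (y i ord0 k - y j ord0 k) ^+ 2.
  rewrite exchange_big /=; apply: eq_bigr => i _; exact: exchange_big.
have step k i := mixed_HK_step t i k eps0 hx.
rewrite addrC -lerBlDr; apply: le_trans (energy_linearised _ _ eps0) _.
rewrite !coord -sumrB mulr_sumr -sumrN; apply: ler_sum => k _.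
rewrite lerBlDl.
apply: le_trans (averaging_dissipation (b := fun i => 1 - alpha t i) _ e_refl _
  (step k)) _; first exact: close_sym.
  by move=> i; have /andP[cb1 ->] := cb i; rewrite (le_trans c0).
rewrite -mulrA lerD2l lerN2 ler_wpM2l // mulr_sumr; apply: ler_sum => i _.
have /andP[cb1 _] := cb i.
have := laplacian_le_step (c := c) e_refl _ (step k i).
by rewrite card_ord; apply; rewrite c0 cb1.
Qed.

(** * From the upper limit to a uniform bound *)

(** The strict inequality passes through [m] so that the bound on the tail is
    uniform, as the suprema of the tails decrease to the upper limit. *)
Lemma limn_esup_lt_eventually (R : realType) (u : nat -> \bar R) (l : \bar R) :
  (limn_esup u < l)%E ->
  exists T, exists2 m, (m < l)%E & forall t, (T <= t)%N -> (u t <= m)%E.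
Proof.
rewrite limn_esup_lim (cvg_lim _ (@cvg_esups_inf R u)) //.
move=> /ereal_inf_lt[_ [T _ <-] Tl]; exists T, (esups u T) => // t Tt.
by apply: ereal_sup_ubound; exists t.
Qed.

Lemma eventually_not_stubborn (R : realType) (n : nat)
    (alpha : nat -> 'I_n -> R) :
  (0 < n)%N ->
  (limn_esup (fun t => max_stubbornness (alpha t)) < 1)%E ->
  exists T, exists2 c, 0 < c & forall t i, (T <= t)%N -> c <= 1 - alpha t i.
Proof.
move=> n0 /limn_esup_lt_eventually[T [m m1 um]]; exists T.
have am t i : (T <= t)%N -> ((alpha t i)%:E <= m)%E.
  move=> Tt; apply: le_trans (um t Tt).
  exact: (le_bigmax _ (fun i => (alpha t i)%:E) i).
(* Having at least one agent excludes the bound -oo. *)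
case: m m1 um am => [a a1 _ am|//|_ _ am]; last first.
  by have := am T (Ordinal n0) (leqnn _).
exists (1 - a); first by rewrite subr_gt0 -lte_fin.
by move=> t i Tt; have := am t i Tt; rewrite lee_fin => ?; rewrite lerD2l lerN2.
Qed.

(** * Short edges make small components *)

(** Each coordinate varies by at most [n * g] along a component; the factor [d]
    sums this over the coordinates. *)
Lemma components_delta_trivial (R : realType) (n d : nat) (eps delta g : R)
    (y : 'I_n -> 'rV[R]_d) (G : {set 'I_n}) :
  0 <= eps -> 0 <= delta -> 0 <= g -> d%:R * (n%:R * g) ^+ 2 <= delta ^+ 2 ->
  (forall i j, close eps y i j -> sqdist (y i) (y j) <= g ^+ 2) ->
  G \in components (profile eps y) -> delta_trivial delta y G.
Proof.
move=> eps0 delta0 g0 gd short.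
have psym : symmetric (profile eps y).
  by move=> i j; rewrite /profile eq_sym -!/(close _ _ _ _) close_sym.
case/imsetP=> a _ -> i j; rewrite !inE => /andP[_ ai] /andP[_ aj].
have ij : connect (profile eps y) i j.
  by apply: connect_trans aj; rewrite sym_connect_sym.
rewrite enorm_sub_le //; apply: le_trans gd.
rewrite -[d in d%:R]card_ord mulr_natl -sumr_const; apply: ler_sum => k _.
rewrite -real_normK ?num_real // lerXn2r ?nnegrE ?mulr_ge0 //.
have := connect_dist (p := fun i => y i ord0 k) g0 _ ij.
rewrite card_ord; apply=> b c /andP[_ bc].
rewrite -ler_sqr ?nnegrE // real_normK ?num_real //.
apply: le_trans (short b c bc).
by rewrite /sqdist (bigD1 k) //= lerDl sumr_ge0 // => l _; exact: sqr_ge0.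
Qed.

Theorem theorem3 (R : realType) (n d : nat) (eps : R)
    (alpha : nat -> 'I_n -> R) (x : nat -> 'I_n -> 'rV[R]_d)
    (hn : (0 < n)%N) (heps : 0 < eps)
    (halpha : forall (t : nat) (i : 'I_n), 0 <= alpha t i <= 1)
    (hx : mixed_HK eps alpha x)
    (hlimsup : (limn_esup (fun t : nat => max_stubbornness (alpha t)) < 1)%E) :
  forall delta : R, 0 < delta -> (tau eps delta x < +oo)%E.
Proof.
move=> delta delta0; have eps0 := ltW heps.
have [B xB] := mixed_HK_bounded eps0 halpha hx.
have [T [c c0 ac]] := eventually_not_stubborn hn hlimsup.
have nR0 : 0 < n%:R :> R by rewrite ltr0n.
have dR0 : 0 <= d%:R :> R by exact: ler0n.
(* Edges of length [g] give d (n g)^2 = d / (d + 1)^2 * delta^2 <= delta^2; the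
   shift by 1 covers d = 0. *)
pose g := delta / (n%:R * (d%:R + 1)).
have g0 : 0 < g by rewrite divr_gt0 // mulr_gt0 // ltr_wpDl.
pose M := d%:R * (n%:R * B ^+ 2).
have M0 : 0 <= M by rewrite mulr_ge0 // mulr_ge0 ?sqr_ge0 // ltW.
(* [M] bounds the sum of |x_i|^2. The weight [s] makes s * M at most g^2 / 2,
   which leaves g^2 / 2 for W / s; the shift by 1 covers M = 0. *)
pose s := g ^+ 2 / (2 * (M + 1)).
have g20 : 0 < g ^+ 2 by exact: exprn_gt0.
have s0 : 0 < s by apply: divr_gt0 => //; lra.
pose W t := \sum_(k < d) \sum_i
  laplacian (close eps (x t)) (fun j => x t j ord0 k) i ^+ 2.
have [t Tt Wt] : exists2 t, (T <= t)%N & W t <= s * (g ^+ 2 / 2).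
  apply: (bounded_descent (f := fun t => energy eps (x t))
    (k := 4 * (c / n%:R) ^+ 2)).
  - by apply: mulr_gt0 => //; apply: exprn_gt0; exact: divr_gt0.
  - by apply: mulr_gt0 => //; lra.
  - by move=> t; exact: energy_ge0.
  - move=> t Tt; apply: energy_decay (ltW c0) _ hx => // i.
    by rewrite ac //= gerBl; case/andP: (halpha t i).
apply: (@le_lt_trans _ _ (t%:R)%:E); last exact: ltry.
apply: ereal_inf_lbound; exists t => // G.
apply: (components_delta_trivial eps0 (ltW delta0) (ltW g0)).
  have -> : d%:R * (n%:R * g) ^+ 2 = d%:R / (d%:R + 1) ^+ 2 * delta ^+ 2.
    by rewrite /g; field; rewrite !gt_eqF // ltr_wpDl.
  by rewrite ler_piMl ?sqr_ge0 // ler_pdivrMr ?exprn_gt0 ?ltr_wpDl //; nra.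
move=> i j ij; set e := close eps (x t) in ij *.
have : \sum_(k < d) \sum_a \sum_(b | e a b) (x t a ord0 k - x t b ord0 k) ^+ 2
    <= g ^+ 2.
  apply: (@le_trans _ _ (s * M + W t / s)); last first.
    have : W t / s <= g ^+ 2 / 2 by rewrite ler_pdivrMr // mulrC.
    have : s * M <= g ^+ 2 / 2; last by lra.
    have -> : g ^+ 2 / 2 = s * (M + 1).
      by rewrite /s; field; rewrite gt_eqF // ltr_wpDl.
    by rewrite ler_wpM2l ?(ltW s0) // lerDl.
  have -> : s * M = \sum_(k < d) s * (n%:R * B ^+ 2).
    by rewrite sumr_const card_ord -[RHS]mulr_natl /M mulrCA.
  rewrite /W mulr_suml -big_split; apply: ler_sum => k _ /=.
  have := edges_le_laplacian (e := e) (p := fun a => x t a ord0 k)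
    (B := B) _ s0.
  by rewrite card_ord; apply=> //; exact: close_sym.
apply: le_trans; apply: ler_sum => k _.
rewrite (bigD1 i) //= (bigD1 j) //= -addrA lerDl addr_ge0 ?sumr_ge0 //.
- by move=> b _; exact: sqr_ge0.
- by move=> a _; apply: sumr_ge0 => b _; exact: sqr_ge0.
Qed.
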